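(* Let $H$ be a complex separable Hilbert space and let $T=(T_1,\ldots,T_d)$, $\tilde T=(\tilde T_1,\ldots,\tilde T_d)$ be two commuting operator-valued multishifts on $\ell^2_H(\mathbb N^d)$ with respective invertible operator weights $\{A^{(j)}_\alpha:\alpha\in\mathbb N^d,\ j=1,\ldots,d\}$ and $\{\tilde A^{(j)}_\alpha:\alpha\in\mathbb N^d,\ j=1,\ldots,d\}$. Let $\mathscr B=\{B_\alpha:\alpha\in\mathbb N^d\}$ and $\tilde{\mathscr B}=\{\tilde B_\alpha:\alpha\in\mathbb N^d\}$ be the associated multisequences of moments. Suppose that $\mathcal H^2(\mathscr B)$ and $\mathcal H^2(\tilde{\mathscr B})$ have the same set $\Omega$ of bounded point evaluations and that $\Omega$ has non-empty interior. Then $T$ and $\tilde T$ are unitarily equivalent if and only if there exists a unitary operator $U$ on $H$ such that $$U B_\alpha^*B_\alpha=\tilde B_\alpha^*\tilde B_\alpha U\quad\text{for all }\alpha\in\mathbb N^d.$$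
   Context: $\mathbb N$ is the set of non-negative integers, $d\ge1$, and $\varepsilon_j\in\mathbb N^d$ has $1$ in the $j$th place and $0$ elsewhere. $\ell^2_H(\mathbb N^d)=\oplus_{\alpha\in\mathbb N^d}H$. Given invertible bounded operators $A^{(j)}_\alpha$ on $H$, the operator-valued multishift $T=(T_1,\dots,T_d)$ on $\ell^2_H(\mathbb N^d)$ with these weights is $T_j(\oplus_\alpha x_\alpha)=\oplus_\alpha A^{(j)}_{\alpha-\varepsilon_j}x_{\alpha-\varepsilon_j}$, where the $\alpha$-entry is $0$ if $\alpha_j=0$. It is commuting if $\sup_\alpha\|A^{(j)}_\alpha\|<\infty$ for every $j$ (equivalently each $T_j$ is bounded) and $A^{(i)}_{\alpha+\varepsilon_j}A^{(j)}_\alpha=A^{(j)}_{\alpha+\varepsilon_i}A^{(i)}_\alpha$ for all $\alpha,i,j$ (equivalently the $T_j$ commute). Moments: $A^{(j)}(\alpha,k)=A^{(j)}_{\alpha-\varepsilon_j}A^{(j)}_{\alpha-2\varepsilon_j}\cdots A^{(j)}_{\alpha-k\varepsilon_j}$ for $1\le k\le\alpha_j$, $A^{(j)}(\alpha,0)=I$, and $$B_\alpha=A^{(1)}(\alpha,\alpha_1)\,A^{(2)}(\alpha-\alpha_1\varepsilon_1,\alpha_2)\cdots A^{(d)}\Big(\alpha-\sum_{l=1}^{d-1}\alpha_l\varepsilon_l,\ \alpha_d\Big),$$ an invertible bounded operator on $H$. $\tilde B_\alpha$ is defined by the same formula from the weights $\tilde A^{(j)}_\alpha$. $\mathcal H^2(\mathscr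 B)$ is the Hilbert space of formal power series $\sum_{\alpha\in\mathbb N^d}x_\alpha z^\alpha$, $x_\alpha\in H$, with $\sum_\alpha\|B_\alpha x_\alpha\|^2<\infty$, with inner product $\langle\sum x_\alpha z^\alpha,\sum y_\alpha z^\alpha\rangle=\sum_\alpha\langle B_\alpha x_\alpha,B_\alpha y_\alpha\rangle_H$; similarly $\mathcal H^2(\tilde{\mathscr B})$. A point $w\in\mathbb C^d$ is a bounded point evaluation on $\mathcal H^2(\mathscr B)$ if the map $p\mapsto p(w)$ from the $H$-valued polynomials in $\mathcal H^2(\mathscr B)$ to $H$ extends to a continuous linear map $\mathcal H^2(\mathscr B)\to H$. $T$ and $\tilde T$ are unitarily equivalent if there is a unitary $V$ on $\ell^2_H(\mathbb N^d)$ with $VT_j=\tilde T_jV$ for all $j$. *)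

(* Defs.v *)
From HB Require Import structures.
From mathcomp Require Import all_boot all_order all_algebra sesquilinear.
From mathcomp Require Import all_classical all_reals all_analysis.
From mathcomp Require Import complex ring lra.

Set Implicit Arguments.
Unset Strict Implicit.
Unset Printing Implicit Defensive.

Import Order.TTheory GRing.Theory Num.Theory.
Import numFieldNormedType.Exports.

Local Open Scope classical_set_scope.
Local Open Scope complex_scope.
Local Open Scope ring_scope.

HB.instance Definition _ (R : realType) :=
  NormedModule.copy R[i] (R[i] : numFieldType)^o.

(* A dot product is linear in its first and conjugate-linear in its second
   argument. *)
HB.mixin Record NormedModule_hasInner (R : realType) H & NormedModule R[i] H := {
  inner : {dot H for @Num.conj R[i]};
  sqr_normE : forall x : H, `|x| ^+ 2 = inner x x
}.

#[short(type="preHilbertType")]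
HB.structure Definition PreHilbert (R : realType) :=
  {H of NormedModule R[i] H & NormedModule_hasInner R H}.

#[short(type="hilbertType")]
HB.structure Definition Hilbert (R : realType) :=
  {H of PreHilbert R H & Complete H}.

Section DotNorm.
Variables (C : numClosedFieldType) (U : lmodType C) (form : {dot U for @Num.conj C}).
Local Notation "''[' u , v ]" := (form u%R v%R) : ring_scope.
Local Notation "''[' u ]" := '[u, u]%R : ring_scope.

Lemma dot_conj u v : '[v, u] = ('[u, v])^*.
Proof. by rewrite [LHS]hermC expr0 mul1r. Qed.

Lemma dot_CauchySchwarz u v : `|'[u, v]| ^+ 2 <= '[u] * '[v].
Proof.
have [->|v0] := eqVneq v 0; first by rewrite !(linear0r form) normr0 expr0n /= mulr0.
have pv : 0 < '[v] by rewrite dnorm_gt0.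
have cv : ('[v])^* = '[v] by apply/CrealP; rewrite gtr0_real.
have e : '['[v] *: u, '[u, v] *: v] = '[v] * `|'[u, v]| ^+ 2.
  rewrite (linearZl_LR form) (linearZr_LR form) /=.
  by rewrite normCK [X in _ * X]mulrC.
have e3 : ('[v] * `|'[u, v]| ^+ 2)^* = '[v] * `|'[u, v]| ^+ 2.
  by apply/CrealP; apply: ger0_real; rewrite mulr_ge0 ?exprn_ge0 ?(ltW pv).
rewrite -(ler_pM2l pv) -subr_ge0.
suff -> : '[v] * ('[u] * '[v]) - '[v] * `|'[u, v]| ^+ 2 =
  '['[v] *: u - '[u, v] *: v] by apply: dnorm_ge0.
have := dnormB form ('[v] *: u) ('[u, v] *: v).
rewrite /= => ->; rewrite !dnormZ e e3 (ger0_norm (ltW pv)).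
set a := '[u]; set b := '[v]; set c := `|_| ^+ 2.
rewrite opprD addrA [c * b]mulrC addrK; congr (_ - _).
by rewrite expr2 -mulrA [a * b]mulrC.
Qed.

Definition dot_norm u := sqrtC '[u].

Lemma dot_norm_ge0 u : 0 <= dot_norm u. Proof. exact: sqrt_dnorm_ge0. Qed.

Lemma sqr_dot_norm u : dot_norm u ^+ 2 = '[u]. Proof. exact: sqrtCK. Qed.

Lemma dot_normD u v : dot_norm (u + v) <= dot_norm u + dot_norm v.
Proof.
rewrite -(@ler_pXn2r _ 2) ?nnegrE ?addr_ge0 ?dot_norm_ge0//.
rewrite sqr_dot_norm sqrrD !sqr_dot_norm dnormD [X in _ <= X]addrAC lerD2l.
set d := '[u, v].
have cs : `|d| <= dot_norm u * dot_norm v.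
  rewrite -(@ler_pXn2r _ 2) ?nnegrE ?mulr_ge0 ?dot_norm_ge0//.
  by rewrite exprMn !sqr_dot_norm dot_CauchySchwarz.
have rd : d + d^* \is Num.real by rewrite CrealE rmorphD /= conjCK addrC.
apply: (le_trans (real_ler_norm rd)); apply: (le_trans (ler_normD _ _)).
by rewrite norm_conjC -mulr2n lerMn2r cs orbT.
Qed.

Lemma dot_normZ a u : dot_norm (a *: u) = `|a| * dot_norm u.
Proof.
apply: (@pexpIrn _ 2); rewrite ?nnegrE ?mulr_ge0 ?dot_norm_ge0//.
by rewrite exprMn !sqr_dot_norm dnormZ.
Qed.

Lemma dot_norm0 u : dot_norm u = 0 -> u = 0.
Proof. by move/eqP; rewrite sqrt_dnorm_eq0 => /eqP. Qed.
End DotNorm.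

Section Sums.
Variables (R : realType) (I : choiceType).
Implicit Types (f g h : I -> R) (F : I -> \bar R).

Definition rsummable f := summable [set: I] (EFin \o f).

(* Unordered sum of an absolutely summable real family. *)
Definition rsum f : R := fine (\esum_(i in [set: I]) (EFin \o f)^\+ i
                             - \esum_(i in [set: I]) (EFin \o f)^\- i)%E.

Lemma esumZ_le (c : R) f : 0 <= c -> (forall i, 0 <= f i) ->
  (\esum_(i in [set: I]) (c * f i)%:E <= c%:E * \esum_(i in [set: I]) (f i)%:E)%E.
Proof.
move=> c0 f0; apply: ge_ereal_sup => _ [X [finX _] <-].
have -> : (\sum_(i \in X) (c * f i)%:E = c%:E * \sum_(i \in X) (f i)%:E)%E.
  rewrite !fsbig_finite//= ge0_sume_distrr//.
  by move=> i _; rewrite lee_fin.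
by rewrite lee_wpmul2l ?lee_fin// esum_ge//; exists X.
Qed.

Lemma esumZ (c : R) f : 0 <= c -> (forall i, 0 <= f i) ->
  (\esum_(i in [set: I]) (c * f i)%:E = c%:E * \esum_(i in [set: I]) (f i)%:E)%E.
Proof.
move=> c0 f0; apply/eqP; rewrite eq_le esumZ_le//=.
have [->|cN0] := eqVneq c 0.
  by rewrite mul0e esum_ge0// => i _; rewrite mul0r.
have cp : 0 < c by rewrite lt_neqAle eq_sym cN0.
have /= := @esumZ_le c^-1 (fun i => c * f i).
rewrite invr_ge0 => /(_ c0 (fun i => mulr_ge0 c0 (f0 i))).
rewrite (eq_esum (b := fun i => (f i)%:E)); last first.
  by move=> i _; rewrite mulKf.
by rewrite lee_pdivlMl.
Qed.

Lemma rsummable_le f g :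
  (forall i, `|f i| <= `|g i|) -> rsummable g -> rsummable f.
Proof. by move=> fg; apply: le_lt_trans; apply: le_esum => i _; rewrite lee_fin. Qed.

Lemma rsummableD f g : rsummable f -> rsummable g -> rsummable (f \+ g).
Proof. exact: summableD. Qed.

Lemma rsummableZ c f : rsummable f -> rsummable (fun i => c * f i).
Proof.
rewrite /rsummable /summable => sf.
rewrite (eq_esum (b := fun i => (`|c| * `|f i|)%:E)); last first.
  by move=> i _; rewrite /= normrM.
by rewrite esumZ//; apply: lte_mul_pinfty; rewrite ?lee_fin.
Qed.

Definition nsum f := \esum_(i in [set: I]) (f i)%:E.

Lemma nsum_fin f : (forall i, 0 <= f i) -> rsummable f -> nsum f \is a fin_num.
Proof.
move=> f0; rewrite /rsummable summableE.
by rewrite (eq_esum (b := fun i => (f i)%:E))// => i _ /=; rewrite ger0_norm.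
Qed.

Lemma rsum_split f g h : (forall i, 0 <= g i) -> (forall i, 0 <= h i) ->
  rsummable g -> rsummable h -> (forall i, f i = g i - h i) ->
  rsum f = fine (nsum g) - fine (nsum h).
Proof.
move=> g0 h0 sg sh fE; have -> : f = g \- h by apply/funext.
rewrite /rsum.
have := @esumB R I setT (EFin \o g) (EFin \o h) sg sh.
have -> : (EFin \o (g \- h)) = ((EFin \o g) \- (EFin \o h))%E by [].
move=> -> //; first by rewrite fineB// -/(nsum _) nsum_fin.
- by move=> i _; rewrite lee_fin.
- by move=> i _; rewrite lee_fin.
Qed.

Definition rpos f i := Num.max (f i) 0.
Definition rneg f i := Num.max (- f i) 0.
Lemma rpos_ge0 f i : 0 <= rpos f i. Proof. by rewrite le_max lexx orbT. Qed.
Lemma rneg_ge0 f i : 0 <= rneg f i. Proof. by rewrite le_max lexx orbT. Qed.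
Lemma rpos_rneg f i : f i = rpos f i - rneg f i.
Proof. by rewrite /rpos /rneg; case: (lerP (f i) 0); case: (lerP (- f i) 0); lra. Qed.
Lemma rpos_summable f : rsummable f -> rsummable (rpos f).
Proof.
apply: rsummable_le => i; rewrite ger0_norm ?rpos_ge0// /rpos.
by rewrite ge_max ler_norm normr_ge0.
Qed.
Lemma rneg_summable f : rsummable f -> rsummable (rneg f).
Proof.
apply: rsummable_le => i; rewrite ger0_norm ?rneg_ge0// /rneg.
by rewrite ge_max normr_ge0 -normrN ler_norm.
Qed.
Hint Resolve rpos_ge0 rneg_ge0 rpos_summable rneg_summable : core.

Lemma nsumD f g : (forall i, 0 <= f i) -> (forall i, 0 <= g i) ->
  nsum (f \+ g) = (nsum f + nsum g)%E.
Proof. by move=> f0 g0; rewrite /nsum -esumD // => i _; rewrite lee_fin. Qed.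

Lemma rsumE f : rsummable f -> rsum f = fine (nsum (rpos f)) - fine (nsum (rneg f)).
Proof. by move=> sf; apply: rsum_split => //; [exact: rpos_summable|exact: rneg_summable|exact: rpos_rneg]. Qed.

Lemma rsum_nneg f : (forall i, 0 <= f i) -> rsummable f -> rsum f = fine (nsum f).
Proof.
move=> f0 sf; rewrite (@rsum_split f f (fun=> 0))//.
- have -> : nsum (fun=> 0) = 0%E by apply: esum1.
  by rewrite /= subr0.
- by apply: (rsummable_le _ sf) => i; rewrite normr0.
- by move=> i; rewrite subr0.
Qed.

Lemma rsumD f g : rsummable f -> rsummable g -> rsum (f \+ g) = rsum f + rsum g.
Proof.
move=> sf sg; rewrite !rsumE//; last exact: rsummableD.
rewrite -rsumE; last exact: rsummableD.
rewrite (@rsum_split _ (rpos f \+ rpos g) (rneg f \+ rneg g)).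
- by rewrite !nsumD// !fineD ?nsum_fin//; [lra|auto..].
- by move=> i; rewrite addr_ge0.
- by move=> i; rewrite addr_ge0.
- by apply: rsummableD; auto.
- by apply: rsummableD; auto.
- by move=> i /=; rewrite {1}rpos_rneg {1}(rpos_rneg g); lra.
Qed.

Lemma rsumN f : rsummable f -> rsum (fun i => - f i) = - rsum f.
Proof.
move=> sf; rewrite (@rsum_split _ (rneg f) (rpos f)); auto.
- by rewrite rsumE// opprB.
- by move=> i; rewrite {1}rpos_rneg opprB.
Qed.

Lemma rsumZ_ge0 (c : R) f : 0 <= c -> rsummable f -> rsum (fun i => c * f i) = c * rsum f.
Proof.
move=> c0 sf; rewrite (@rsum_split _ (fun i => c * rpos f i) (fun i => c * rneg f i)).
- have nZ g : (forall i, 0 <= g i) -> rsummable g ->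
      fine (nsum (fun i => c * g i)) = c * fine (nsum g).
    by move=> g0 sg; rewrite /nsum esumZ// fineM// -/(nsum _) nsum_fin.
  by rewrite !nZ; auto; rewrite -mulrBr rsumE.
- by move=> i; rewrite mulr_ge0.
- by move=> i; rewrite mulr_ge0.
- by apply: rsummableZ; auto.
- by apply: rsummableZ; auto.
- by move=> i /=; rewrite {1}rpos_rneg; lra.
Qed.

Lemma rsumZ (c : R) f : rsummable f -> rsum (fun i => c * f i) = c * rsum f.
Proof.
move=> sf; have [c0|c0] := leP 0 c; first exact: rsumZ_ge0.
have -> : (fun i => c * f i) = (fun i => - (- c * f i)).
  by apply/funext => i; rewrite mulNr opprK.
rewrite rsumN; last exact: rsummableZ.
by rewrite rsumZ_ge0 ?oppr_ge0 ?(ltW c0)// mulNr opprK.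
Qed.

Lemma rsum_eq0 f : (forall i, 0 <= f i) -> rsummable f -> rsum f = 0 ->
  forall i, f i = 0.
Proof.
move=> f0 sf; rewrite rsum_nneg// => n0 i.
have e : nsum f = 0%E by rewrite -(fineK (nsum_fin f0 sf)) n0.
apply/eqP; rewrite eq_le f0 andbT -lee_fin.
have -> : 0%:E = nsum f by [].
apply: esum_ge; exists [set i]; first by split.
by rewrite fsbig_set1.
Qed.

End Sums.

Section ComplexSums.
Variables (R : realType) (I : choiceType).
Implicit Types f g : I -> R[i].

Definition csum f : R[i] :=
  rsum (fun i => complex.Re (f i)) +i* rsum (fun i => complex.Im (f i)).

Definition csummable f := rsummable (fun i => complex.Re `|f i|).

Lemma Re_le_norm (z : R[i]) : `|complex.Re z| <= `|complex.Re `|z| |.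
Proof.
rewrite normc_def /= [leRHS]ger0_norm ?sqrtr_ge0//.
by rewrite -sqrtr_sqr ler_wsqrtr// lerDl sqr_ge0.
Qed.

Lemma Im_le_norm (z : R[i]) : `|complex.Im z| <= `|complex.Re `|z| |.
Proof.
rewrite normc_def /= [leRHS]ger0_norm ?sqrtr_ge0//.
by rewrite -sqrtr_sqr ler_wsqrtr// lerDr sqr_ge0.
Qed.

Lemma csummable_Re f : csummable f -> rsummable (fun i => complex.Re (f i)).
Proof. by apply: rsummable_le => i; exact: Re_le_norm. Qed.

Lemma csummable_Im f : csummable f -> rsummable (fun i => complex.Im (f i)).
Proof. by apply: rsummable_le => i; exact: Im_le_norm. Qed.
Hint Resolve csummable_Re csummable_Im : core.

Lemma csumD f g : csummable f -> csummable g -> csum (f \+ g) = csum f + csum g.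
Proof.
move=> sf sg; rewrite /csum.
rewrite -[RHS]/((_ + _) +i* (_ + _)) -!rsumD; auto.
by congr (_ +i* _); congr rsum; apply/funext => i /=; case: (f i); case: (g i).
Qed.

Lemma csumZ c f : csummable f -> csum (fun i => c * f i) = c * csum f.
Proof.
move=> sf; case: c => a b; rewrite /csum.
rewrite -[RHS]/((_ - _) +i* (_ + _)) -!rsumZ; auto.
have sN (h : I -> R) : rsummable h -> rsummable (fun i => - h i).
  by move=> sh; apply: rsummable_le sh => i; rewrite normrN.
rewrite -rsumN; last by apply: rsummableZ; auto.
rewrite -rsumD; [|by apply: rsummableZ; auto|by apply: sN; apply: rsummableZ; auto].
rewrite -rsumD; [|by apply: rsummableZ; auto|by apply: rsummableZ; auto].
by congr (_ +i* _); congr rsum; apply/funext => i /=; case: (f i).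
Qed.

Lemma csum_conj f : csummable f -> csum (fun i => (f i)^*) = (csum f)^*.
Proof.
move=> sf; rewrite /csum -[RHS]/(_ +i* - _) -rsumN; auto.
by congr (_ +i* _); congr rsum; apply/funext => i /=; case: (f i).
Qed.

Lemma csum_ge0 f : (forall i, 0 <= f i) -> csummable f ->
  csum f = (rsum (fun i => complex.Re (f i)))%:C.
Proof.
move=> f0 sf; rewrite /csum; congr (_ +i* _).
have -> : (fun i => complex.Im (f i)) = (fun i => 0 * complex.Re (f i)).
  by apply/funext => i; rewrite mul0r; apply: ger0_Im.
by rewrite rsumZ ?mul0r; auto.
Qed.

Lemma rsum_ge0 (f : I -> R) : (forall i, 0 <= f i) -> rsummable f -> 0 <= rsum f.
Proof.
move=> f0 sf; rewrite rsum_nneg// fine_ge0//.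
by apply: esum_ge0 => i _; rewrite lee_fin.
Qed.

End ComplexSums.

Section Operators.
Variables (R : realType) (H : hilbertType R).

(* Invertible bounded operators: for linear maps between normed modules,
   bounded is continuous. *)
Record invop := Invop {
  invop_fun :> {linear H -> H};
  invop_continuous : continuous invop_fun;
  invop_inverse : exists W : {linear H -> H},
    [/\ continuous W, cancel invop_fun W & cancel W invop_fun]
}.

Lemma invop_id_continuous : continuous (idfun : H -> H).
Proof. by move=> x; exact: cvg_id. Qed.

Lemma invop_id_inverse : exists W : {linear H -> H},
  [/\ continuous W, cancel (idfun : H -> H) W & cancel W (idfun : H -> H)].
Proof. by exists idfun; split=> //; exact: invop_id_continuous. Qed.

Definition invop_id : invop := Invop invop_id_continuous invop_id_inverse.

Lemma invop_comp_continuous (A B : invop) : continuous (A \o B).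
Proof. by move=> x; apply: continuous_comp; exact: invop_continuous. Qed.

Lemma invop_comp_inverse (A B : invop) : exists W : {linear H -> H},
  [/\ continuous W, cancel (A \o B) W & cancel W (A \o B)].
Proof.
have [V [cV AV VA]] := invop_inverse A; have [W [cW BW WB]] := invop_inverse B.
exists (W \o V); split=> [x|x|x] /=.
- by apply: continuous_comp; [exact: cV|exact: cW].
- by rewrite AV BW.
- by rewrite WB VA.
Qed.

Definition invop_comp (A B : invop) : invop :=
  Invop (@invop_comp_continuous A B) (@invop_comp_inverse A B).

Lemma invop_inj (A : invop) : injective A.
Proof. by have [W [_ AW _]] := invop_inverse A; exact: can_inj AW. Qed.

(* For a bounded linear A, the set below is a singleton by the Riesz
   representation theorem; the default 0 is then never used. *)
Definition adjoint (A : H -> H) : H -> H :=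
  fun y => xget 0 [set z | forall x, inner (A x) y = inner x z].

(* The library's norm on a normed module over R[i] takes values in R[i]. *)
Definition rnorm (x : H) : R := complex.Re `|x|.

Definition opnorm (A : H -> H) : \bar R :=
  ereal_sup [set (rnorm (A x))%:E | x in [set x | rnorm x <= 1]].

End Operators.

Section H2.
Variables (R : realType) (H : hilbertType R) (I : choiceType).
Variable B : I -> invop H.
Implicit Types x y : I -> H.

Definition H2_pred : {pred I -> H} := fun x =>
  `[< (\esum_(a in [set: I]) (rnorm (B a (x a)) ^+ 2)%:E < +oo)%E >].

Lemma rnormE (v : H) : `|v| = (rnorm v)%:C.
Proof. by rewrite /rnorm RRe_real// normr_real. Qed.

Lemma rnorm_ge0 (v : H) : 0 <= rnorm v.
Proof. by have := normr_ge0 v; rewrite rnormE ler0c. Qed.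

Lemma rnormD (v w : H) : rnorm (v + w) <= rnorm v + rnorm w.
Proof. by rewrite -lecR rmorphD /= -!rnormE; exact: ler_normD. Qed.

Lemma rnormZ c (v : H) : rnorm (c *: v) = complex.Re `|c| * rnorm v.
Proof.
apply: (@complexI R); rewrite rmorphM /= -!rnormE normrZ normc_def; case: c => a b; congr (_%:C * _).
Qed.

Lemma H2_predP x : x \in H2_pred <-> rsummable (fun a => rnorm (B a (x a)) ^+ 2).
Proof.
rewrite /rsummable /summable (eq_esum (b := fun a => (rnorm (B a (x a)) ^+ 2)%:E)).
  by split=> [/asboolP//|h]; apply/asboolP.
by move=> a _; rewrite /= ger0_norm ?sqr_ge0.
Qed.

Lemma H2_submod_closed : submod_closed H2_pred.
Proof.
split.
  apply/H2_predP; apply: (@rsummable_le _ _ _ (fun=> 0)) => [a|].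
    rewrite -[(0 : I -> H) a]/(0 : H) linear0.
    by rewrite /rnorm normr0 /= expr0n /= normr0.
  by rewrite /rsummable /summable esum1// => a _ /=; rewrite normr0.
move=> c x y /H2_predP sx /H2_predP sy; apply/H2_predP.
pose k := complex.Re `|c|.
apply: (@rsummable_le _ _ _ (fun a => (2 * k ^+ 2) * rnorm (B a (x a)) ^+ 2 +
   2 * rnorm (B a (y a)) ^+ 2)); last first.
  by apply: rsummableD; apply: rsummableZ.
have k0 : 0 <= k by rewrite /k normc_def /= sqrtr_ge0.
move=> a; rewrite ger0_norm ?sqr_ge0// ger0_norm; last first.
  by rewrite addr_ge0 ?mulr_ge0 ?exprn_ge0 ?rnorm_ge0 ?ler0n.
rewrite -[(c *: x + y) a]/(c *: x a + y a) linearP.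
have := rnormD (c *: B a (x a)) (B a (y a)); rewrite rnormZ -/k.
move: (rnorm (B a (x a))) (rnorm_ge0 (B a (x a))) (rnorm (B a (y a)))
  (rnorm_ge0 (B a (y a))) (rnorm (_ + _)) (rnorm_ge0 (c *: B a (x a) + B a (y a))).
move=> u u0 v v0 s s0 le; apply: (@le_trans _ _ ((k * u + v) ^+ 2)).
  by rewrite ler_pXn2r ?nnegrE// addr_ge0 ?mulr_ge0.
have := sqr_ge0 (k * u - v); nra.
Qed.

HB.instance Definition _ := GRing.isSubmodClosed.Build R[i] (I -> H) H2_pred H2_submod_closed.

(* H2 B is the space of formal power series with coefficient family (x_a)
   such that the squared norms of the B_a x_a are summable; with B constantly
   the identity it is the l2 direct sum of copies of H. *)
Record H2 := MkH2 { H2_coef :> I -> H; _ : H2_coef \in H2_pred }.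

HB.instance Definition _ := [isSub for H2_coef].
HB.instance Definition _ := [Choice of H2 by <:].
HB.instance Definition _ := [SubChoice_isSubLmodule of H2 by <:].

Implicit Types p q : H2.

Definition H2_inner p q : R[i] := csum (fun a => inner (B a (p a)) (B a (q a))).

Lemma H2_coefP c p q a : (c *: p + q) a = c *: p a + q a.
Proof. by []. Qed.

Lemma inner_le (v w : H) : complex.Re `|inner v w| <= rnorm v ^+ 2 + rnorm w ^+ 2.
Proof.
have h : complex.Re `|inner v w| <= rnorm v * rnorm w.
  have := dot_CauchySchwarz (@inner R H) v w.
  rewrite -!sqr_normE -exprMn ler_pXn2r ?nnegrE ?mulr_ge0//.
  by rewrite !rnormE -rmorphM /= lecE => /andP[].
apply: (le_trans h).
by have := rnorm_ge0 v; have := rnorm_ge0 w; have := sqr_ge0 (rnorm v - rnorm w); nra.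
Qed.

Lemma H2P p : rsummable (fun a => rnorm (B a (p a)) ^+ 2).
Proof. by case: p => p sp; apply/H2_predP. Qed.

Lemma H2_csummable p q : csummable (fun a => inner (B a (p a)) (B a (q a))).
Proof.
apply: (rsummable_le _ (rsummableD (H2P p) (H2P q))) => a.
rewrite [leRHS]ger0_norm ?addr_ge0 ?exprn_ge0 ?rnorm_ge0//.
rewrite ger0_norm; first exact: inner_le.
by rewrite normc_def /= sqrtr_ge0.
Qed.

Lemma H2_innerDl q : {morph H2_inner^~ q : p p' / p + p'}.
Proof.
move=> p p'; rewrite /H2_inner -csumD; [|exact: H2_csummable..].
by congr csum; apply/funext => a /=; rewrite -linearDl -linearD.
Qed.

Lemma H2_innerZl q c : {morph H2_inner^~ q : p / c *: p >-> c * p}.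
Proof.
move=> p; rewrite /H2_inner -csumZ; last exact: H2_csummable.
congr csum; apply/funext => a /=.
by rewrite linearZ (linearZl_LR (@inner R H)).
Qed.

Lemma H2_innerC p q : H2_inner p q = (H2_inner q p)^*.
Proof.
rewrite /H2_inner -[RHS]csum_conj; last exact: H2_csummable.
by congr csum; apply/funext => a; exact: dot_conj.
Qed.

Lemma H2_inner_bilinear :
  bilinear_for ( *%R : R[i] -> R[i] -> R[i]) (@Num.conj R[i] \; *%R) H2_inner.
Proof.
split=> [q c p p'|q c p p'].
  by rewrite H2_innerDl H2_innerZl.
rewrite H2_innerC H2_innerDl H2_innerZl rmorphD rmorphM /=.
by rewrite -!H2_innerC.
Qed.

HB.instance Definition _ := bilinear_isBilinear.Build R[i] H2 H2 R[i]
  *%R (@Num.conj R[i] \; *%R) H2_inner H2_inner_bilinear.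

Lemma H2_inner_herm p q : H2_inner p q = (-1) ^+ false * (H2_inner q p)^*.
Proof. by rewrite mul1r H2_innerC. Qed.

HB.instance Definition _ := isHermitianSesquilinear.Build R[i] H2 false
  (@Num.conj R[i]) H2_inner H2_inner_herm.

Lemma H2_inner_gt0 p : p != 0 -> 0 < H2_inner p p.
Proof.
move=> pN0.
have ge0 a : 0 <= inner (B a (p a)) (B a (p a)) by rewrite -sqr_normE exprn_ge0.
have Re0 a : 0 <= complex.Re (inner (B a (p a)) (B a (p a))).
  by have := ge0 a; rewrite lecE => /andP[].
have s := H2_csummable p p.
rewrite /H2_inner csum_ge0// ltcR lt_neqAle rsum_ge0 ?andbT; auto; last first.
  exact: csummable_Re.
apply: contra pN0; rewrite eq_sym => /eqP /rsum_eq0 z.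
apply/eqP/val_inj/funext => a /=.
apply: (@invop_inj _ _ (B a)); rewrite [RHS]linear0; apply/eqP.
rewrite -(dnorm_eq0 (@inner R H)) eq_complex (z Re0 (csummable_Re s)) eqxx /=.
by rewrite ger0_Im.
Qed.

HB.instance Definition _ := isDotProduct.Build R[i] H2 H2_inner H2_inner_gt0.

HB.instance Definition _ := Lmodule_isNormed.Build R[i] H2
  (dot_normD (H2_inner : {dot H2 for @Num.conj R[i]}))
  (dot_normZ (H2_inner : {dot H2 for @Num.conj R[i]}))
  (@dot_norm0 _ _ (H2_inner : {dot H2 for @Num.conj R[i]})).

Lemma H2_sqr_norm p : `|p| ^+ 2 = (H2_inner : {dot H2 for @Num.conj R[i]}) p p.
Proof. exact: sqr_dot_norm. Qed.

HB.instance Definition _ := NormedModule_hasInner.Build R H2 H2_sqr_norm.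

End H2.

Definition unitary (R : realType) (E F : preHilbertType R) (V : {linear E -> F}) :=
  (forall x y, inner (V x) (V y) = inner x y) /\ (forall y, exists x, V x = y).

Definition separable (X : topologicalType) := exists2 D : set X, countable D & dense D.

Notation mindex d := {ffun 'I_d -> nat}.

Notation ell2 H d := (H2 (fun _ : mindex d => invop_id H)).

Section Multishift.
Variables (R : realType) (H : hilbertType R) (d : nat).
Implicit Types (a : mindex d) (j : 'I_d).

Definition mineps j : mindex d := [ffun i => nat_of_bool (i == j)].

Definition minsub a b : mindex d := [ffun i => (a i - b i)%N].

Definition weights := 'I_d -> mindex d -> invop H.

Implicit Type A : weights.

Definition commuting A :=
  (forall j, (ereal_sup (range (fun a => opnorm (A j a))) < +oo)%E) /\
  (forall a i j x, A i (a + mineps j) (A j a x) = A j (a + mineps i) (A i a x)).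

Definition shift A j (x : mindex d -> H) : mindex d -> H := fun a =>
  if a j == 0%N then 0 else A j (minsub a (mineps j)) (x (minsub a (mineps j))).

Lemma commuting_bounded A j : commuting A ->
  exists2 M : R, 0 <= M & forall a v, rnorm (A j a v) <= M * rnorm v.
Proof.
move=> [/(_ j) supA _].
have le0 a : (0 <= opnorm (A j a))%E.
  apply: ereal_sup_ubound; exists 0; last by rewrite linear0 /rnorm normr0.
  by rewrite /= /rnorm normr0 ler01.
have leM a : (opnorm (A j a) <= ereal_sup (range (fun a => opnorm (A j a))))%E.
  by apply: ereal_sup_ubound; exists a.
case: (ereal_sup _) supA leM => [M _ leM| //|_ leM]; last first.
  by have := le_trans (le0 0) (leM 0).
exists M; first by rewrite -lee_fin (le_trans (le0 0) (leM 0)).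
move=> a v; have [->|v0] := eqVneq v 0.
  by rewrite linear0 /rnorm normr0 mulr0.
have pv : 0 < rnorm v by rewrite -ltcR -rnormE normr_gt0.
have nv : complex.Re `|((rnorm v)^-1)%:C| = (rnorm v)^-1.
  by rewrite ger0_norm// ler0c invr_ge0 ltW.
have : ((rnorm (A j a (((rnorm v)^-1)%:C *: v)))%:E <= M%:E)%E.
  apply: le_trans (leM a); apply: ereal_sup_ubound.
  exists (((rnorm v)^-1)%:C *: v) => //=.
  by rewrite rnormZ nv mulVf ?lt0r_neq0.
by rewrite lee_fin linearZ rnormZ nv mulrC ler_pdivrMr.
Qed.

Lemma shift_ell2 A (hA : commuting A) j (x : ell2 H d) :
  shift A j x \in H2_pred (fun _ : mindex d => invop_id H).
Proof.
apply/asboolP; have [M M0 leM] := commuting_bounded j hA.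
have -> : (\esum_(a in [set: mindex d]) (rnorm (shift A j x a) ^+ 2)%:E =
  \esum_(a in range (fun a => (a + mineps j)%R)) (rnorm (shift A j x a) ^+ 2)%:E)%E.
  rewrite [RHS]esum_mkcond; apply: eq_esum => a _; case: ifPn => // /negP aN.
  rewrite /shift; case: eqP => [_|aj]; first by rewrite /rnorm normr0 expr0n.
  exfalso; apply: aN; apply/mem_set; exists (minsub a (mineps j)) => //.
  apply/ffunP => i; rewrite !ffunE; case: eqP => [->|_]; last first.
    by rewrite subn0 addr0.
  by apply: subnK; rewrite lt0n; apply/eqP.
rewrite esum_image; last first.
  move=> a b _ _ /ffunP e; apply/ffunP => i; have := e i; rewrite !ffunE.
  exact: addIn.
apply: (@le_lt_trans _ _ (\esum_(a in [set: mindex d]) (M ^+ 2 * rnorm (x a) ^+ 2)%:E)%E).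
  apply: le_esum => a _; rewrite lee_fin -exprMn ler_pXn2r ?nnegrE ?mulr_ge0 ?rnorm_ge0//.
  rewrite /shift; case: eqP => _; first by rewrite /rnorm normr0 mulr_ge0 ?rnorm_ge0.
  have -> : minsub (a + mineps j) (mineps j) = a.
    by apply/ffunP => i; rewrite !ffunE; exact: addnK.
  exact: leM.
rewrite esumZ ?sqr_ge0//; last by move=> a; exact: sqr_ge0.
apply: lte_mul_pinfty => //; first by rewrite lee_fin sqr_ge0.
exact: (asboolW (valP x)).
Qed.

Definition multishift A (hA : commuting A) j (x : ell2 H d) : ell2 H d :=
  MkH2 (shift_ell2 hA j x).

Lemma multishift_linear A (hA : commuting A) j : linear (multishift hA j).
Proof.
move=> c x y; apply/val_inj/funext => a /=.
rewrite -[RHS]/(c *: shift A j x a + shift A j y a) /shift.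
case: eqP => _; first by rewrite scaler0 addr0.
exact: linearP.
Qed.

HB.instance Definition _ A (hA : commuting A) j :=
  GRing.isLinear.Build R[i] (ell2 H d) (ell2 H d) *:%R (multishift hA j)
    (multishift_linear hA j).

Definition unitarily_equivalent (S T : 'I_d -> ell2 H d -> ell2 H d) :=
  exists V : {linear ell2 H d -> ell2 H d},
    unitary V /\ forall j x, V (S j x) = T j (V x).

(* A^(j)(a, k): the big operator composes from left to right, so the factor
   m = 1 is applied last. *)
Definition ray_moment A j a k : invop H :=
  \big[@invop_comp R H/invop_id H]_(1 <= m < k.+1) A j (minsub a (mineps j *+ m)).

Definition moment A a : invop H :=
  \big[@invop_comp R H/invop_id H]_(j < d)
    ray_moment A j (minsub a (\sum_(l < d | (l < j)%N) mineps l *+ a l)) (a j).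

Definition monomial (w : 'rV[R[i]]_d) a : R[i] := \prod_(i < d) w 0 i ^+ a i.

(* Polynomials are the finitely supported series; the sum is then finite. *)
Definition bounded_point_evaluation (B : mindex d -> invop H) (w : 'rV[R[i]]_d) :=
  exists E : {linear H2 B -> H}, continuous E /\
    forall p : H2 B, finite_set [set a | p a != 0] ->
      E p = \sum_(a \in [set: mindex d]) monomial w a *: p a.

End Multishift.

(* Main.v *)
From HB Require Import structures.
Require Import Defs.
From mathcomp Require Import all_boot all_order all_algebra sesquilinear.
From mathcomp Require Import all_classical all_reals all_analysis complex ring lra.

Set Implicit Arguments.
Unset Strict Implicit.
Unset Printing Implicit Defensive.

Import Order.TTheory GRing.Theory Num.Theory.
Import numFieldNormedType.Exports.

Local Open Scope classical_set_scope.
Local Open Scope complex_scope.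
Local Open Scope ring_scope.

(** The two tuples of shifts are compared through what a unitary [V] does to the
    vectors concentrated at the multi-index 0. Write [delta a h] for the family
    with entry [h] at [a] and 0 elsewhere.

    If [V T_j = Tt_j V] for all [j], then [V] sends [delta 0 x] to some
    [delta 0 (U x)]. Indeed, every [delta (a + eps_j) h] is in the range of
    [Tt_j], because the weights are invertible; since [V] is onto, it equals
    [Tt_j (V q) = V (T_j q)], and [<V (T_j q), V (delta 0 x)> =
    <T_j q, delta 0 x> = 0] because [T_j q] has no entry at 0. The same
    argument read backwards shows that [U] is onto ([intertwiner_const],
    [intertwiner_const_surj]). The recursion [B_(a + eps_j) = A^(j)_a B_a]
    ([momentD], which uses that the shifts commute) makes [delta a (B_a x)] the
    image of [delta 0 x] under a product of shifts, hence
    [V (delta a (B_a x)) = delta a (Bt_a (U x))] ([intertwiner_delta]). As [V]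
    is isometric, [<Bt_a U x, Bt_a U y> = <B_a x, B_a y>] for all [x], [y];
    case [a = 0] says that [U] is isometric.

    Conversely these identities say that [W_a := Bt_a U B_a^-1] is unitary on
    [H] for every [a], and the diagonal operator with blocks [W_a] intertwines
    the shifts by the recursion again ([diagonal_unitary],
    [intertwiner_of_unitary]).

    Finally the identities between inner products are equivalent to
    [U B_a^* B_a = Bt_a^* Bt_a U] ([adjoint_intertwineP]). This needs that
    [adjoint], a choice with a default value, is a true adjoint, that is, the
    Riesz representation theorem. It is obtained in [riesz_re] by minimising
    [|z|^2 - 2 Re (f z)]. *)

(** * Riesz representation and adjoints *)

Section RealInner.
Context {R : realType} {H : hilbertType R}.
Implicit Types (u v w : H) (t : R).

Definition re_inner u v : R := complex.Re (inner u v).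

Lemma rnorm_sqr u : rnorm u ^+ 2 = re_inner u u.
Proof.
apply: (@complexI R); rewrite rmorphXn /= -rnormE sqr_normE /re_inner RRe_real// -sqr_normE.
by rewrite realX// normr_real.
Qed.

Lemma re_innerC u v : re_inner u v = re_inner v u.
Proof. by rewrite /re_inner (dot_conj inner); case: (inner v u). Qed.

Lemma re_innerDl u v w : re_inner (u + v) w = re_inner u w + re_inner v w.
Proof.
rewrite /re_inner; have -> : inner (u + v) w = inner u w + inner v w.
  exact: linearDl.
by case: (inner u w); case: (inner v w).
Qed.

Lemma re_innerZl t u w : re_inner (t%:C *: u) w = t * re_inner u w.
Proof.
rewrite /re_inner; have -> : inner (t%:C *: u) w = t%:C * inner u w.
  exact: (linearZl_LR (@inner R H)).
case: (inner u w) => a b /=.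
by rewrite mul0r subr0.
Qed.

Lemma re_innerDr u v w : re_inner w (u + v) = re_inner w u + re_inner w v.
Proof. by rewrite re_innerC re_innerDl !(re_innerC w). Qed.

Lemma re_innerZr t u w : re_inner w (t%:C *: u) = t * re_inner w u.
Proof. by rewrite re_innerC re_innerZl (re_innerC w). Qed.

Lemma re_inner_le u v : `|re_inner u v| <= rnorm u * rnorm v.
Proof.
apply: (le_trans (Re_le_norm _)); rewrite ger0_norm; last first.
  by rewrite normc_def /= sqrtr_ge0.
have := dot_CauchySchwarz (@inner R H) u v.
rewrite -!sqr_normE -exprMn ler_pXn2r ?nnegrE ?mulr_ge0//.
by rewrite !rnormE -rmorphM /= lecE => /andP[].
Qed.

Lemma inner_ext u v : (forall w, inner w u = inner w v) -> u = v.
Proof.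
move=> uv; apply/eqP; rewrite -subr_eq0 -(dnorm_eq0 (@inner R H)).
by rewrite linearBr /= uv subrr.
Qed.

(** The imaginary part of [inner u v] is, up to sign, the real part of
    [inner ('i *: u) v]; this reduces complex representation to real. *)
Lemma inner_re_ext u v w w' :
  re_inner u v = re_inner w w' -> re_inner ('i *: u) v = re_inner ('i *: w) w' ->
  inner u v = inner w w'.
Proof.
have iE (x y : H) : inner ('i *: x) y = 'i * inner x y.
  exact: (linearZl_LR (@inner R H)).
rewrite /re_inner !iE.
case: (inner u v) => a b; case: (inner w w') => c e /= ->.
by rewrite !mul0r !mul1r !sub0r => /oppr_inj ->.
Qed.

(** Completeness in terms of the real norm [rnorm]: radii of balls in [H] are
    elements of [R[i]], which are real as soon as they are positive. *)
Lemma rnorm_complete (u : nat -> H) :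
  (forall e : R, 0 < e -> exists N, forall n m, (N <= n)%N -> (N <= m)%N ->
     rnorm (u n - u m) < e) ->
  exists l, forall e : R, 0 < e -> exists N, forall n, (N <= n)%N ->
    rnorm (l - u n) < e.
Proof.
move=> cu.
have Re_gt0 (e : R[i]) : 0 < e -> 0 < complex.Re e /\ e = (complex.Re e)%:C.
  by move=> e0; split; [move: e0; rewrite ltcE => /andP[]|rewrite RRe_real// gtr0_real].
have : cauchy (u @ \oo).
  apply/cauchy_ballP => e /Re_gt0[e0 eE].
  have [N uN] := cu _ e0.
  pose tail := u @` [set n | (N <= n)%N].
  have tailu : (u @ \oo) tail by exists N => // n Nn; exists n.
  exists (tail, tail) => //= -[_ _] [[n Nn <-] [m Nm <-]].
  by rewrite /ball_ -ball_normE /= eE rnormE ltcR uN.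
move=> /cauchy_cvg /cvg_ex[l /cvgrPdist_lt ul].
exists l => e e0; have /ul[N _ lN] : 0 < e%:C by rewrite ltcR.
by exists N => n Nn; have := lN n Nn; rewrite /= rnormE ltcR.
Qed.

(** The representing vector is the minimiser of [J z = |z|^2 - 2 g z]. The
    parallelogram law [mid] makes any minimising sequence Cauchy; since [J] is
    almost minimal along it, varying [J] in the direction [u] bounds
    [re_inner u (z n) - g u] by a quantity that tends to 0. *)
Lemma riesz_re (g : H -> R) (M : R) :
  {morph g : u v / u + v} -> (forall t u, g (t%:C *: u) = t * g u) ->
  (forall u, `|g u| <= M * rnorm u) ->
  exists z, forall u, g u = re_inner u z.
Proof.
move=> gD gZ gM.
pose J z := rnorm z ^+ 2 - 2 * g z.
have JZ t u v : J (u + t%:C *: v) =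
    J u + t ^+ 2 * rnorm v ^+ 2 + 2 * t * (re_inner v u - g v).
  rewrite /J !rnorm_sqr gD gZ re_innerDl !re_innerDr !re_innerZl !re_innerZr.
  by rewrite (re_innerC u v); ring.
have mid u v : J u + J v - 2 * J (u + (2^-1)%:C *: (v - u)) =
    2^-1 * rnorm (v - u) ^+ 2.
  rewrite JZ.
  have -> : J v = J (u + 1%:C *: (v - u)) by rewrite scale1r addrC subrK.
  by rewrite JZ; field.
pose S := [set J z | z in setT].
have infS : has_inf S.
  split; first by exists (J 0), 0.
  (* J z >= |z|^2 - 2 M |z| >= - M^2 *)
  exists (- M ^+ 2) => _ [z _ <-]; rewrite /J.
  have := gM z; rewrite ler_norml => /andP[_ h].
  by have := sqr_ge0 (rnorm z - M); nra.
have Jge z : inf S <= J z by apply: ge_inf; [exact: infS.2|exists z].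
have step n : exists z, J z < inf S + n.+1%:R^-1.
  have n0 : 0 < n.+1%:R^-1 :> R by rewrite invr_gt0.
  by have [_ [z _ <-] zlt] := inf_adherent n0 infS; exists z.
have [z zJ] := choice step.
have small (e : R) : 0 < e -> exists N, forall n, (N <= n)%N -> n.+1%:R^-1 < e.
  move=> e0; have [N _ hN] := near_infty_natSinv_lt (PosNum e0).
  by exists N => n Nn; have := hN n Nn.
have [|l zl] := @rnorm_complete z.
  move=> e e0; have [|N hN] := small (e ^+ 2 / 4); first by rewrite divr_gt0 ?exprn_gt0.
  exists N => n m /hN hn /hN hm.
  rewrite -(@ltr_pXn2r _ 2) ?nnegrE ?rnorm_ge0 ?(ltW e0)//.
  have := mid (z m) (z n); have := Jge (z m + (2^-1)%:C *: (z n - z m)).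
  move: hn hm (zJ n) (zJ m); move: (inf S) (n.+1%:R^-1) (m.+1%:R^-1) => i en em.
  move: (J (z n)) (J (z m)) (rnorm _ ^+ 2) (e ^+ 2) => a b r s.
  lra.
(* The defect D of the limit at u is at most |<u, l - z n>| + |c|, where c is
   the defect of z n; both terms are made smaller than D / 2. *)
exists l => u; apply/eqP; rewrite eq_sym -subr_eq0 -normr_le0.
rewrite leNgt; apply/negP.
set D := `|_| => D0; set K := rnorm u ^+ 2.
have K0 : 0 <= K by exact: sqr_ge0.
have [|N1 hN1] := zl (D / 2 / (rnorm u + 1)).
  by rewrite !divr_gt0// ltr_wpDl ?rnorm_ge0.
have [|N2 hN2] := small ((D / 2) ^+ 2 / (K + 1)).
  by rewrite divr_gt0 ?exprn_gt0 ?divr_gt0// ltr_wpDl.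
pose n := maxn N1 N2.
have := hN1 n (leq_maxl _ _); have := hN2 n (leq_maxr _ _); move: (zJ n).
move: (n.+1%:R^-1) => en zn.
rewrite !ltr_pdivlMr ?ltr_wpDl ?rnorm_ge0// => he hl.
set c := re_inner u (z n) - g u.
have c2 : c ^+ 2 <= en * (K + 1).
  (* - c / K minimises t^2 K + 2 t c; dividing by K + 1 covers u = 0 *)
  have := Jge (z n + (- (c / (K + 1)))%:C *: u); rewrite JZ -/K -/c => h.
  have {h} h : 0 <= en + (c / (K + 1)) ^+ 2 * K - 2 * (c / (K + 1)) * c.
    by move: zn h; rewrite sqrrN; lra.
  have K1 : K + 1 != 0 by rewrite gt_eqF// ltr_wpDl.
  move: h; set q := c / _; have -> : c = q * (K + 1) by rewrite /q divfK.
  by have := sqr_ge0 q; nra.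
have cD : `|c| < D / 2.
  rewrite -(@ltr_pXn2r _ 2) ?nnegrE ?divr_ge0 ?(ltW D0)//.
  by rewrite -normrX ger0_norm ?sqr_ge0//; apply: le_lt_trans he.
have lD : `|re_inner u (l - z n)| < D / 2.
  apply: le_lt_trans (re_inner_le _ _) _.
  by have := rnorm_ge0 (l - z n); nra.
have : D <= `|re_inner u (l - z n)| + `|c|.
  apply: le_trans (ler_normD _ _); rewrite /D /c.
  have -> : re_inner u l = re_inner u (l - z n) + re_inner u (z n).
    by rewrite -re_innerDr subrK.
  by rewrite addrA.
lra.
Qed.

Lemma continuous_rnorm_le (A : {linear H -> H}) : continuous A ->
  exists M : R, forall u, rnorm (A u) <= M * rnorm u.
Proof.
move=> /(_ 0) /cvgrPdist_lt /(_ 1 ltr01) /nbhs_ballP[e /= e0].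
have e0' : 0 < complex.Re e by move: e0; rewrite ltcE => /andP[].
have eE : e = (complex.Re e)%:C by rewrite RRe_real// gtr0_real.
rewrite eE -ball_normE; set r := complex.Re e => h.
exists (2 / r) => u; have [->|u0] := eqVneq u 0.
  by rewrite linear0 /rnorm normr0 mulr0.
have pu : 0 < rnorm u by rewrite -ltcR -rnormE normr_gt0.
pose k := r / 2 / rnorm u.
have k0 : 0 < k by rewrite !divr_gt0.
have nk v : rnorm (k%:C *: v) = k * rnorm v.
  by rewrite rnormZ ger0_norm// ler0c ltW.
have kr : ball_ (fun v : H => `|v|) 0 r%:C (k%:C *: u).
  rewrite /ball_ /= sub0r normrN rnormE nk ltcR divfK ?gt_eqF//.
  by rewrite ltr_pdivrMr// ltr_pMr// ltr1n.
have := h _ kr; rewrite /= linear0 sub0r normrN linearZ rnormE nk -[1]/(1%:C) ltcR => /ltW.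
rewrite /k mulrAC ler_pdivrMr// mul1r => le.
rewrite -(ler_pM2l (_ : 0 < r / 2)) ?divr_gt0//; apply: le_trans le _.
by rewrite le_eqVlt; apply/orP; left; apply/eqP; field; rewrite gt_eqF.
Qed.

(** By the Riesz theorem the set from which [adjoint] chooses is not empty. *)
Lemma adjointP (A : {linear H -> H}) : continuous A ->
  forall u v, inner (A u) v = inner u (adjoint A v).
Proof.
move=> /continuous_rnorm_le[M AM] u v; move: u.
rewrite /adjoint; case: xgetP => [z -> /(_ _) zP|noz]; first exact: zP.
exfalso; have [|t u|u|z zP] := @riesz_re (fun u => re_inner (A u) v) (M * rnorm v).
- by move=> u w; rewrite linearD re_innerDl.
- by rewrite linearZ re_innerZl.
- apply: (le_trans (re_inner_le _ _)).
  by rewrite mulrAC ler_wpM2r ?rnorm_ge0.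
- apply: (noz z) => u; apply: inner_re_ext; first exact: zP.
  by rewrite -linearZ zP.
Qed.

End RealInner.

(** * Recursion for the moments *)

Section Moments.
Context {R : realType} {H : hilbertType R} {d : nat}.
Implicit Types (a b : mindex d) (i j : 'I_d) (A : weights H d).

Lemma mindexDE a b i : (a + b)%R i = (a i + b i)%N.
Proof. by rewrite ffunE. Qed.

Lemma minsubKl a j : minsub (a + mineps j) (mineps j) = a.
Proof. by apply/ffunP => i; rewrite ffunE mindexDE addnK. Qed.

Lemma minsubKr a j : (0 < a j)%N -> minsub a (mineps j) + mineps j = a.
Proof.
move=> aj; apply/ffunP => i; rewrite mindexDE !ffunE; case: eqP => [->|_].
  exact: subnK.
by rewrite subn0 addn0.
Qed.

Lemma mineps_add_gt0 a j : (0 < (a + mineps j)%R j)%N.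
Proof. by rewrite mindexDE ffunE eqxx addn1. Qed.

Lemma mulrn_mineps j k i : (mineps j *+ k) i = ((i == j) * k)%N.
Proof.
elim: k => [|k IH]; first by rewrite mulr0n ffunE muln0.
by rewrite mulrS mindexDE IH ffunE mulnS.
Qed.

Lemma mindex_sumD a j : (\sum_i (a + mineps j)%R i = (\sum_i a i).+1)%N.
Proof.
rewrite (eq_bigr (fun i => (a i + mineps j i)%N)); last by move=> i _; rewrite mindexDE.
rewrite big_split /= -addn1; congr addn.
by rewrite (bigD1 j)//= ffunE eqxx big1// => i /negbTE ij; rewrite ffunE ij.
Qed.

(** Induction along the edges of the lattice: multi-indices are reached from 0
    by adding one unit vector at a time. *)
Lemma mindex_ind (P : mindex d -> Prop) :
  P 0 -> (forall a j, P a -> P (a + mineps j)) -> forall a, P a.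
Proof.
move=> P0 PS a; have [n] := ubnP (\sum_i a i)%N.
elim: n a => // n IH a; rewrite ltnS => an.
have [[j aj]|a0] := pselect (exists j, (0 < a j)%N); last first.
  suff -> : a = 0 by [].
  apply/ffunP => j; rewrite ffunE; apply/eqP; rewrite -leqn0 leqNgt.
  by apply/negP => aj; apply: a0; exists j.
by move: an; rewrite -(minsubKr aj) mindex_sumD => an; apply/PS/IH.
Qed.

(** Two ordered products which agree after position [i], differ by a left factor
    [C] at [i], and are trivial before [i], differ by the left factor [C]:
    nothing stands in front of it, so no commutation is required. *)
Lemma big_invop_seq (F G : 'I_d -> invop H) (C : H -> H) (r : seq 'I_d) i :
  sorted (fun j k : 'I_d => (j < k)%N) r -> i \in r ->
  (forall j : 'I_d, (j < i)%N -> F j =1 id /\ G j =1 id) ->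
  F i =1 C \o G i ->
  (forall j : 'I_d, (i < j)%N -> F j =1 G j) ->
  forall x, (\big[@invop_comp R H/invop_id H]_(j <- r) F j) x =
         C ((\big[@invop_comp R H/invop_id H]_(j <- r) G j) x).
Proof.
move=> + + lt ei gt x.
have tr : transitive (fun j k : 'I_d => (j < k)%N) by move=> ? ? ?; exact: ltn_trans.
elim: r => // k r IH; rewrite /= (path_sortedE tr) => /andP[kr sr].
rewrite !big_cons inE => /predU1P[ik|ir].
  rewrite -{}ik in kr *; rewrite /= ei /=; congr (C (G i _)).
  elim: r kr {IH sr} => [|l r IH] /=; first by rewrite !big_nil.
  by move=> /andP[il kr]; rewrite !big_cons /= gt// IH.
have [/= -> ->] := lt _ (allP kr _ ir).
exact: IH.
Qed.

Lemma ray_moment0 A j a : ray_moment A j a 0 =1 id.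
Proof. by move=> x; rewrite /ray_moment big_geq. Qed.

Lemma ray_momentS A j a k x :
  ray_moment A j (a + mineps j) k.+1 x = A j a (ray_moment A j a k x).
Proof.
rewrite /ray_moment big_ltn// big_add1 /= mulr1n minsubKl.
congr (A j a _); congr (invop_fun _ x).
apply: eq_bigr => m _; congr (A j _).
by apply/ffunP => i; rewrite [LHS]ffunE [RHS]ffunE mindexDE !mulrn_mineps mulnS ffunE subnDA addnK.
Qed.

Lemma minsub_prefix a j i :
  minsub a (\sum_(l < d | (l < j)%N) mineps l *+ a l) i =
  if (i < j)%N then 0%N else a i.
Proof.
rewrite ffunE sum_ffunE; case: ifPn => ij.
  rewrite (bigD1 i)//= mulrn_mineps eqxx mul1n big1 ?addr0 ?subnn//.
  by move=> l /andP[_ li]; rewrite mulrn_mineps eq_sym (negbTE li).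
rewrite big1 ?subn0// => l lj; rewrite mulrn_mineps.
by case: eqP => [il|//]; rewrite il lj in ij.
Qed.

(** The moment [B_a] follows the path from 0 to [a] that climbs the last
    coordinate first and the first coordinate last. If the coordinates of [a]
    before [i] vanish, the path to [a + eps_i] is therefore the path to [a]
    followed by one more step. *)
Lemma moment_first A a i x : (forall j : 'I_d, (j < i)%N -> a j = 0%N) ->
  moment A (a + mineps i) x = A i a (moment A a x).
Proof.
move=> a0; rewrite /moment; apply: (@big_invop_seq _ _ _ _ i).
- have := iota_ltn_sorted 0 d; rewrite -val_enum_ord sorted_map.
  by rewrite /index_enum -enumT.
- by rewrite mem_index_enum.
- move=> j ji; rewrite mindexDE ffunE a0//.
  have -> : (j == i) = false by apply/eqP => e; rewrite e ltnn in ji.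
  by split; exact: ray_moment0.
- move=> {}x /=.
  have prefix0 b : (forall j : 'I_d, (j < i)%N -> b j = 0%N) ->
      minsub b (\sum_(l < d | (l < i)%N) mineps l *+ b l) = b.
    move=> b0; apply/ffunP => j; rewrite minsub_prefix.
    by case: ifP => // /b0.
  rewrite !prefix0//; first by rewrite mindexDE ffunE eqxx addn1 ray_momentS.
  move=> j ji; rewrite mindexDE ffunE a0//; apply/eqP.
  by rewrite add0n eqb0; apply/eqP => e; rewrite e ltnn in ji.
- move=> j ij {}x.
  have ji : (j == i) = false by apply/eqP => e; rewrite e ltnn in ij.
  have -> : minsub (a + mineps i) (\sum_(l < d | (l < j)%N) mineps l *+ (a + mineps i)%R l)
      = minsub a (\sum_(l < d | (l < j)%N) mineps l *+ a l).
    apply/ffunP => k; rewrite !minsub_prefix; case: ifPn => // kj.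
    rewrite mindexDE ffunE; case: eqP => [ki|_]; last by rewrite addn0.
    by rewrite ki ij in kj.
  by rewrite mindexDE ffunE ji addn0.
Qed.

(** For a general direction [j], let [i] be the first nonzero coordinate of [a].
    If [i < j], then the last step of the path to [a + eps_j] is in direction
    [i]; commutation exchanges it with the step in direction [j], which is
    added to the shorter multi-index [a - eps_i] by induction. *)
Lemma momentD A (hA : commuting A) a j x :
  moment A (a + mineps j) x = A j a (moment A a x).
Proof.
have [n] := ubnP (\sum_i a i)%N.
elim: n a => // n IH a; rewrite ltnS => an.
have [[k /andP[kj ak]]|a0] := pselect (exists k : 'I_d, (k < j)%N && (0 < a k)%N);
    last first.
  apply: moment_first => k kj; apply/eqP; rewrite -leqn0 leqNgt.
  by apply/negP => ak; apply: a0; exists k; rewrite kj.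
have [i ai imin] := @arg_minnP _ k (fun i => 0 < a i)%N (fun i => i : nat) ak.
have ij : (i < j)%N by apply: leq_ltn_trans kj; exact: imin.
have a0 (l : 'I_d) : (l < i)%N -> minsub a (mineps i) l = 0%N.
  move=> li; rewrite ffunE; suff /eqP-> : a l == 0%N by [].
  by rewrite -leqn0 leqNgt; apply/negP => /imin; rewrite leqNgt li.
move: an; rewrite -(minsubKr ai); move: (minsub a _) a0 => b b0.
rewrite mindex_sumD => bn.
rewrite (moment_first A x b0) addrAC moment_first; last first.
  move=> l li; rewrite mindexDE ffunE b0//; apply/eqP.
  by rewrite add0n eqb0; apply/eqP => e; rewrite e ltnNge (ltnW ij) in li.
by rewrite IH// hA.2.
Qed.

Lemma moment0 A x : moment A 0 x = x.
Proof.
rewrite /moment; set F := BIG_F.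
have F0 j : F j =1 id by rewrite /F ffunE; exact: ray_moment0.
by elim: (index_enum 'I_d) => [|j r IH]; rewrite ?big_nil// big_cons /= F0.
Qed.

End Moments.

(** * One-point families and diagonal operators on the l2 sum *)

Section Ell2.
Context {R : realType} {H : hilbertType R} {d : nat}.
Implicit Types (a b : mindex d) (i j : 'I_d) (A : weights H d) (p q : ell2 H d).

Lemma ell2_innerE p q : inner p q = csum (fun a => inner (p a) (q a)).
Proof. by []. Qed.

Lemma ell2_ext p q : (forall a, p a = q a) -> p = q.
Proof. by move=> pq; apply/val_inj/funext. Qed.

Lemma esum_single (I : choiceType) (f : I -> \bar R) (i : I) :
  (0 <= f i)%E -> (forall k, k != i -> f k = 0%E) ->
  (\esum_(k in [set: I]) f k = f i)%E.
Proof.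
move=> fi f0; transitivity (\esum_(k in [set i]) f k)%E; last by rewrite esum_set1.
rewrite [RHS]esum_mkcond; apply: eq_esum => k _; case: ifPn => // /negP ki.
by apply: f0; apply/eqP => e; apply: ki; rewrite e inE.
Qed.

Lemma rsum_single (I : choiceType) (f : I -> R) (i : I) :
  (forall k, k != i -> f k = 0) -> rsum f = f i.
Proof.
move=> f0; rewrite /rsum !(@esum_single _ _ i) ?funepos_ge0 ?funeneg_ge0//.
- by have := congr1 (fun g => g i) (funeposneg (EFin \o f)) => /= <-.
- by move=> k /f0 fk; rewrite funenegE /= fk oppr0 maxxx.
- by move=> k /f0 fk; rewrite funeposE /= fk maxxx.
Qed.

Lemma csum_single (I : choiceType) (f : I -> R[i]) (i : I) :
  (forall k, k != i -> f k = 0) -> csum f = f i.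
Proof.
move=> f0; rewrite /csum !(@rsum_single _ _ i); first by case: (f i).
- by move=> k /f0 ->.
- by move=> k /f0 ->.
Qed.

Definition delta_fun a (h : H) : mindex d -> H := fun b => if b == a then h else 0.

Lemma delta_subproof a h :
  delta_fun a h \in H2_pred (fun _ : mindex d => invop_id H).
Proof.
apply/asboolP; rewrite (@esum_single _ _ a) ?ltry//.
  by rewrite lee_fin sqr_ge0.
move=> b /negbTE ba /=; rewrite /delta_fun ba.
by rewrite /rnorm normr0 expr0n.
Qed.

Definition delta a h : ell2 H d := MkH2 (delta_subproof a h).

Lemma deltaE a h b : delta a h b = if b == a then h else 0.
Proof. by []. Qed.

Lemma delta_linear a : linear (delta a).
Proof.
move=> c x y; apply: ell2_ext => b.
by rewrite H2_coefP !deltaE; case: eqP => // _; rewrite scaler0 addr0.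
Qed.

Lemma inner_delta a h p : inner (delta a h) p = inner h (p a).
Proof.
rewrite ell2_innerE (@csum_single _ _ a) ?deltaE ?eqxx// => b /negbTE ba.
by rewrite deltaE ba (linear0l (@inner R H)).
Qed.

Lemma inner_delta2 a h k : inner (delta a h) (delta a k) = inner h k.
Proof. by rewrite inner_delta deltaE eqxx. Qed.

Lemma ell2_delta0 p : (forall a j, p (a + mineps j) = 0) -> p = delta 0 (p 0).
Proof.
move=> p0; apply: ell2_ext => b; rewrite deltaE.
elim/(@mindex_ind d): b => [|b j _]; first by rewrite eqxx.
rewrite p0; case: eqP => // bj.
by have := mineps_add_gt0 b j; rewrite bj ffunE.
Qed.

Lemma multishift_delta A (hA : commuting A) j a h :
  multishift hA j (delta a h) = delta (a + mineps j) (A j a h).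
Proof.
apply: ell2_ext => b; rewrite deltaE /= /Defs.shift.
have [->|ba] := eqVneq b (a + mineps j).
  by rewrite gtn_eqF ?mineps_add_gt0// minsubKl /delta_fun eqxx.
case: eqP => // /eqP bj; rewrite /delta_fun.
case: eqP => [e|_]; last by rewrite linear0.
by case/eqP: ba; rewrite -e minsubKr// lt0n.
Qed.

Lemma inner_multishift_delta0 A (hA : commuting A) j p h :
  inner (multishift hA j p) (delta 0 h) = 0.
Proof.
rewrite (dot_conj inner) inner_delta /= /Defs.shift ffunE eqxx.
by rewrite (linear0r (@inner R H)) conjC0.
Qed.

(** The blocks preserve norms, so square summability is preserved in both
    directions. *)
Lemma diagonal_unitary (W : mindex d -> {linear H -> H}) :
  (forall a, unitary (W a)) ->
  exists V : {linear ell2 H d -> ell2 H d},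
    unitary V /\ forall p a, V p a = W a (p a).
Proof.
move=> uW.
have Wn a v : rnorm (W a v) = rnorm v.
  by apply/eqP; rewrite -(@eqrXn2 _ 2) ?rnorm_ge0// !rnorm_sqr /re_inner (uW a).1.
have VP p : (fun a => W a (p a)) \in H2_pred (fun _ : mindex d => invop_id H).
  by apply/H2_predP; apply: (rsummable_le _ (H2P p)) => a /=; rewrite Wn.
pose V p : ell2 H d := MkH2 (VP p).
have Vlin : linear V.
  move=> c p q; apply: ell2_ext => a.
  by rewrite H2_coefP /= -linearP.
pose VL : {linear ell2 H d -> ell2 H d} :=
  HB.pack V (GRing.isLinear.Build R[i] (ell2 H d) (ell2 H d) *:%R V Vlin).
exists VL; split=> //; split=> [p q|q].
  by rewrite !ell2_innerE; congr csum; apply/funext => a; exact: (uW a).1.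
have /choice[z zW] a : exists z, W a z = q a by exact: (uW a).2.
have zP : z \in H2_pred (fun _ : mindex d => invop_id H).
  by apply/H2_predP; apply: (rsummable_le _ (H2P q)) => a /=; rewrite -zW Wn.
by exists (MkH2 zP); apply: ell2_ext => a; exact: zW.
Qed.

End Ell2.

(** * Unitary equivalence of multishifts *)

Section UnitaryEquivalence.
Context {R : realType} {H : hilbertType R} {d : nat}.
Context {A At : weights H d} (hA : commuting A) (hAt : commuting At).

(** Both conditions say that [inner (B x) (B y)] and [inner (Bt (U x)) (Bt (U y))]
    agree, one after moving [B] and [Bt] to the right-hand argument; the
    vectors [U y] are enough to test equality because [U] is onto. *)
Lemma adjoint_intertwineP (B Bt : invop H) (U : {linear H -> H}) : unitary U ->
  (forall x, U (adjoint B (B x)) = adjoint Bt (Bt (U x))) <->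
  (forall x y, inner (Bt (U x)) (Bt (U y)) = inner (B x) (B y)).
Proof.
move=> [Ui Us]; split=> [UB x y|iso x].
  by rewrite (adjointP (@invop_continuous _ _ Bt)) -UB Ui
    (adjointP (@invop_continuous _ _ B)).
apply: inner_ext => w; have [y <-] := Us w.
by rewrite Ui -(adjointP (@invop_continuous _ _ Bt))
  -(adjointP (@invop_continuous _ _ B)).
Qed.

Section Rigidity.
Context {V : {linear ell2 H d -> ell2 H d}}.
Context (uV : unitary V).
Context (VT : forall j p, V (multishift hA j p) = multishift hAt j (V p)).

(** Every [delta (a + eps_j) h] is of the form [V (T_j q)], and [T_j q] is
    orthogonal to [delta 0 x]. *)
Lemma intertwiner_const x : V (delta 0 x) = delta 0 (V (delta 0 x) 0).
Proof.
apply: ell2_delta0 => a j; apply: inner_ext => h.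
rewrite (linear0r (@inner R H)) -inner_delta.
have [W [_ _ AtW]] := invop_inverse (At j a).
have [q qE] := uV.2 (delta a (W h)).
rewrite -[h]AtW -multishift_delta -{}qE -VT uV.1.
exact: inner_multishift_delta0.
Qed.

(** Same argument as [intertwiner_const], applied to the inverse of [V]. *)
Lemma intertwiner_const_surj y : exists x, V (delta 0 x) = delta 0 y.
Proof.
have [p pE] := uV.2 (delta 0 y); exists (p 0); rewrite -pE; congr (V _).
apply/esym/ell2_delta0 => a j; apply: inner_ext => h.
rewrite (linear0r (@inner R H)) -inner_delta.
have [W [_ _ AW]] := invop_inverse (A j a).
rewrite -[h]AW -multishift_delta -uV.1 pE VT.
exact: inner_multishift_delta0.
Qed.

(** [V] is determined by its values at the multi-index 0, because products of
    shifts carry [delta 0 x] to [delta a (B_a x)]. *)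
Lemma intertwiner_delta a x :
  V (delta a (moment A a x)) = delta a (moment At a (V (delta 0 x) 0)).
Proof.
elim/(@mindex_ind d): a => [|a j IH]; first by rewrite !moment0 -intertwiner_const.
by rewrite !momentD// -!multishift_delta VT IH.
Qed.

Lemma intertwiner_unitary : exists U : {linear H -> H}, unitary U /\
  forall a x y, inner (moment At a (U x)) (moment At a (U y)) =
                inner (moment A a x) (moment A a y).
Proof.
pose U x := V (delta 0 x) 0.
have Ulin : linear U by move=> c x y; rewrite /U delta_linear linearP.
pose UL : {linear H -> H} := HB.pack U (GRing.isLinear.Build R[i] H H *:%R U Ulin).
have iso a x y : inner (moment At a (U x)) (moment At a (U y)) =
                inner (moment A a x) (moment A a y).
  by rewrite -(inner_delta2 a) -!intertwiner_delta uV.1 inner_delta2.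
exists UL; split=> //; split=> [x y|y]; first by have := iso 0 x y; rewrite !moment0.
have [x xE] := intertwiner_const_surj y.
by exists x; rewrite /= /U xE deltaE eqxx.
Qed.

End Rigidity.

(** The intertwiner is diagonal with the unitary blocks [Bt_a U B_a^-1]. *)
Lemma intertwiner_of_unitary (U : {linear H -> H}) : unitary U ->
  (forall a x y, inner (moment At a (U x)) (moment At a (U y)) =
                 inner (moment A a x) (moment A a y)) ->
  unitarily_equivalent (multishift hA) (multishift hAt).
Proof.
move=> [_ Us] iso.
have /choice[W WE] a : exists W : {linear H -> H},
    forall x, W (moment A a x) = moment At a (U x).
  have [Bi [_ BK KB]] := invop_inverse (moment A a).
  by exists (moment At a \o U \o Bi) => x /=; rewrite BK.
have Bsurj (B : invop H) v : exists x, B x = v.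
  by have [Bi [_ _ KB]] := invop_inverse B; exists (Bi v).
have [a|V [uV VE]] := @diagonal_unitary R H d W.
  split=> [v w|v].
    have [x <-] := Bsurj (moment A a) v; have [y <-] := Bsurj (moment A a) w.
    by rewrite !WE iso.
  have [y <-] := Bsurj (moment At a) v; have [x <-] := Us y.
  by exists (moment A a x).
exists V; split=> // j p; apply: ell2_ext => a; rewrite VE /= /Defs.shift.
case: eqP => [_|/eqP]; first by rewrite linear0.
rewrite -lt0n => aj; rewrite VE -{1}(minsubKr aj); move: (minsub a _) => b.
have [x <-] := Bsurj (moment A b) (p b).
by rewrite -momentD// !WE momentD.
Qed.

End UnitaryEquivalence.

Theorem theorem5p8 (R : realType) (H : hilbertType R) (d : nat)
    (A At : weights H d) (hA : commuting A) (hAt : commuting At)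
    (Omega : set 'rV[R[i]]_d) :
  (0 < d)%N ->
  separable H ->
  [set w | bounded_point_evaluation (moment A) w] = Omega ->
  [set w | bounded_point_evaluation (moment At) w] = Omega ->
  Omega° !=set0 ->
  unitarily_equivalent (multishift hA) (multishift hAt) <->
  exists U : {linear H -> H}, unitary U /\
    forall a : mindex d, forall x : H,
      U (adjoint (moment A a) (moment A a x)) =
      adjoint (moment At a) (moment At a (U x)).
Proof.
move=> _ _ _ _ _; split=> [[V [uV VT]]|[U [uU UB]]].
  have [U [uU iso]] := intertwiner_unitary uV VT.
  by exists U; split=> // a; apply/(adjoint_intertwineP _ _ uU).
apply: (intertwiner_of_unitary hA hAt uU) => a.
exact/(adjoint_intertwineP _ _ uU).
Qed.
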